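(* Let $M,N,L\ge1$ be integers, $p,\alpha_{\rm s}>0$, and let $\mathbf h_{\rm c},\mathbf h_{\rm s}\in\mathbb C^{M\times1}$ be nonzero. For unit-norm $\mathbf w\in\mathbb C^{M\times1}$ let $\mathcal R_{\rm c}(\mathbf w)=\log_2(1+p|\mathbf w^{\mathsf H}\mathbf h_{\rm c}|^2)$ and $\mathcal R_{\rm s}(\mathbf w)=L^{-1}\log_2(1+pNL\alpha_{\rm s}|\mathbf w^{\mathsf H}\mathbf h_{\rm s}|^2)$, and let $\alpha_{12}=p\sqrt{NL\alpha_{\rm s}}\,\mathbf h_{\rm c}^{\mathsf H}\mathbf h_{\rm s}$. Then the whole Pareto boundary of the rate region (the set of pairs $(\mathcal R_{\rm s}(\mathbf w),\mathcal R_{\rm c}(\mathbf w))$, $\lVert\mathbf w\rVert=1$) is achieved by the beamforming vectors $$\mathbf w_\xi=\frac{\xi\mathbf h_{\rm c}+(1-\xi)\mathbf h_{\rm s}e^{-\mathrm j\angle\alpha_{12}}}{\lVert\xi\mathbf h_{\rm c}+(1-\xi)\mathbf h_{\rm s}e^{-\mathrm j\angle\alpha_{12}}\rVert},\qquad \xi\in[0,1];$$ that is, every rate pair on the Pareto boundary equals $(\mathcal R_{\rm s}(\mathbf w_\xi),\mathcal R_{\rm c}(\mathbf w_\xi))$ for some $\xi\in[0,1]$.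
   Context: $\mathcal R_{\rm c}$ is the communication rate to a single-antenna user with channel $\mathbf h_{\rm c}$ and $\mathcal R_{\rm s}$ the sensing rate for a single target with transmit steering vector $\mathbf h_{\rm s}$. A pair $(\mathcal R_{\rm s}(\mathbf w),\mathcal R_{\rm c}(\mathbf w))$ is on the Pareto boundary if there is no unit-norm $\mathbf w'$ with both rates at least as large and at least one strictly larger. $\angle z$ denotes the argument of $z\in\mathbb C$ (with $\angle0=0$) and $\mathrm j$ the imaginary unit. *)

(* Defs.v *)
From HB Require Import structures.
From mathcomp Require Import all_boot all_order all_algebra.
From mathcomp Require Import spectral sesquilinear.
From mathcomp Require Import all_classical all_reals all_analysis.
From mathcomp.real_closed Require Import complex.

Set Implicit Arguments.
Unset Strict Implicit.
Unset Printing Implicit Defensive.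

Import Order.TTheory GRing.Theory Num.Theory.
Local Open Scope ring_scope.
Local Open Scope complex_scope.
Local Open Scope sesquilinear_scope.
Local Open Scope classical_set_scope.

(* The modulus is taken in R: the generic [`|z|] would live in R[i]. *)
Notation cmod := ComplexField.Normc.normc.

Definition cis {R : realType} (t : R) : R[i] := cos t +i* sin t.

(* Principal argument, in ]-pi, pi], with value 0 at 0. *)
Definition carg {R : realType} (z : R[i]) : R :=
  if z == 0 then 0
  else if 0 <= complex.Im z then acos (complex.Re z / cmod z)
  else - acos (complex.Re z / cmod z).

Lemma cargE {R : realType} (z : R[i]) :
  z = (cmod z)%:C * cis (carg z) /\ - pi < carg z <= pi.
Proof.
have pi0 := pi_gt0 R; rewrite /carg; case: eqP => [->|/eqP z0].
  by rewrite ComplexField.Normc.normc0 mul0r oppr_lt0 pi0 ltW.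
case: z z0 => a b /= z0; set m := Num.sqrt _.
have s0 : 0 < a ^+ 2 + b ^+ 2.
  rewrite lt_def addr_ge0 ?sqr_ge0// andbT paddr_eq0 ?sqr_ge0// !sqrf_eq0.
  by apply: contra z0 => /andP[/eqP -> /eqP ->].
have m0 : 0 < m by rewrite sqrtr_gt0.
have m2 : m ^+ 2 = a ^+ 2 + b ^+ 2 by rewrite sqr_sqrtr// ltW.
have am : `|a| <= m by rewrite -sqrtr_sqr ler_wsqrtr// lerDl sqr_ge0.
have h : -1 <= a / m <= 1.
  by rewrite ler_pdivlMr// ler_pdivrMr// mulN1r mul1r -ler_norml.
have cE : m * cos (acos (a / m)) = a.
  by rewrite acosK ?in_itv//= mulrCA divff ?mulr1// gt_eqF.
have sE : m * sin (acos (a / m)) = `|b|.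
  rewrite sin_acos// -{1}(gtr0_norm m0) -sqrtr_sqr -sqrtrM ?sqr_ge0//.
  rewrite mulrBr mulr1 expr_div_n mulrCA divff ?mulr1 ?expf_neq0 ?gt_eqF//.
  by rewrite m2 addrAC subrr add0r sqrtr_sqr.
have := acos_ge0 h; have := acos_lepi h; case: ifP => b0 h1 h2.
  rewrite h1 andbT (lt_le_trans _ h2) ?oppr_lt0//; split=> //.
  by rewrite /cis; simpc; rewrite cE sE ger0_norm.
have bn : b < 0 by rewrite ltNge b0.
split; first by rewrite /cis cosN sinN; simpc; rewrite cE sE ltr0_norm ?opprK.
rewrite ltrN2 (le_trans _ (ltW pi0)) ?oppr_le0// andbT lt_neqAle h1 andbT.
apply: contraTN bn => /eqP e; move: sE; rewrite e sinpi mulr0 => /esym/normr0_eq0 ->.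
by rewrite ltxx.
Qed.

Definition log2 {R : realType} (x : R) : R := ln x / ln 2.

Definition herm_dot {R : realType} {M : nat} (u v : 'cV[R[i]]_M) : R[i] :=
  (u ^t* *m v) 0 0.

(* Euclidean norm; the library's [`|w|] on matrices is the sup norm. *)
Definition norm2 {R : realType} {M : nat} (w : 'cV[R[i]]_M) : R :=
  Num.sqrt (\sum_i cmod (w i 0) ^+ 2).

Definition comm_rate {R : realType} {M : nat} (p : R) (hc w : 'cV[R[i]]_M) : R :=
  log2 (1 + p * cmod (herm_dot w hc) ^+ 2).

Definition sens_rate {R : realType} {M : nat} (N L : nat) (p alpha_s : R)
    (hs w : 'cV[R[i]]_M) : R :=
  L%:R^-1 * log2 (1 + p * N%:R * L%:R * alpha_s * cmod (herm_dot w hs) ^+ 2).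

Definition rate_pair {R : realType} {M : nat} (N L : nat) (p alpha_s : R)
    (hc hs w : 'cV[R[i]]_M) : R * R :=
  (sens_rate N L p alpha_s hs w, comm_rate p hc w).

Definition rate_region {R : realType} {M : nat} (N L : nat) (p alpha_s : R)
    (hc hs : 'cV[R[i]]_M) : set (R * R) :=
  [set rate_pair N L p alpha_s hc hs w | w in [set w | norm2 w = 1]].

Definition pareto_boundary {R : realType} (S : set (R * R)) : set (R * R) :=
  [set x | S x /\
    ~ exists y, [/\ S y, x.1 <= y.1, x.2 <= y.2 & x.1 < y.1 \/ x.2 < y.2]].

Definition alpha12 {R : realType} {M : nat} (N L : nat) (p alpha_s : R)
    (hc hs : 'cV[R[i]]_M) : R[i] :=
  (p * Num.sqrt (N%:R * L%:R * alpha_s))%:C * herm_dot hc hs.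

Definition beam_dir {R : realType} {M : nat} (N L : nat) (p alpha_s : R)
    (hc hs : 'cV[R[i]]_M) (xi : R) : 'cV[R[i]]_M :=
  xi%:C *: hc
  + ((1 - xi)%:C * cis (- carg (alpha12 N L p alpha_s hc hs))) *: hs.

(* For hc, hs nonzero and xi in [0, 1] the direction is nonzero, because the
   phase makes hc^H (e^(-j arg alpha12) hs) = |hc^H hs| >= 0: the inverse below
   is never that of 0. *)
Definition beam {R : realType} {M : nat} (N L : nat) (p alpha_s : R)
    (hc hs : 'cV[R[i]]_M) (xi : R) : 'cV[R[i]]_M :=
  (norm2 (beam_dir N L p alpha_s hc hs xi))^-1%:C
    *: beam_dir N L p alpha_s hc hs xi.

(* Main.v *)
(** For a unit vector w put x = |w^H hc| and y = |w^H hs|, and let A = |hc|^2,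
    B = |hs|^2, g = |hc^H hs|.  Projecting hc and hs orthogonally to w and
    applying Cauchy-Schwarz gives (g - x y)^2 <= (A - x^2) (B - y^2), that is
    x^2 B + y^2 A - 2 x y g <= D with D = A B - g^2.  When the weights
    l = x B - y g and m = y A - x g are both positive, the beam of direction
    l hc + m hs e^(-j arg alpha12) has gains x D / n and y D / n, where n is the
    norm of this direction, and the ellipse inequality says n <= D; otherwise
    xi = 0 or xi = 1 dominates.  Hence every unit w is weakly dominated by some
    beam, and a Pareto-optimal rate pair equals any achievable pair that weakly
    dominates it. *)
Require Import Defs.
From mathcomp Require Import all_boot all_order all_algebra.
From mathcomp Require Import spectral sesquilinear ring lra.
From mathcomp Require Import all_classical all_reals all_analysis.
From mathcomp.real_closed Require Import complex.
Import Order.TTheory GRing.Theory Num.Theory.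
Local Open Scope ring_scope.
Local Open Scope complex_scope.

(** * Hermitian product, Euclidean norm and the Gram inequality *)

Section HermDot.
Context {R : realType} {M : nat}.
Implicit Types (u v w : 'cV[R[i]]_M) (a : R[i]).

(** [dotmx] takes row vectors and conjugates its second argument, hence the transposes and the swap.
    This bridge gives access to Hermitian symmetry, definiteness and Cauchy-Schwarz. *)
Lemma herm_dotE u v : herm_dot u v = dotmx v^T u^T.
Proof.
rewrite /herm_dot dotmxE !mxE; apply: eq_bigr => i _.
by rewrite !mxE mulrC.
Qed.

Lemma herm_dotDr u v w : herm_dot w (u + v) = herm_dot w u + herm_dot w v.
Proof. by rewrite /herm_dot mulmxDr mxE. Qed.

Lemma herm_dotZr a u v : herm_dot u (a *: v) = a * herm_dot u v.
Proof. by rewrite /herm_dot -scalemxAr mxE. Qed.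

Lemma herm_dotC u v : herm_dot v u = Num.conj (herm_dot u v).
Proof. by rewrite !herm_dotE hermC /= expr0 mul1r. Qed.

Lemma herm_dotDl u v w : herm_dot (u + v) w = herm_dot u w + herm_dot v w.
Proof. by rewrite herm_dotC herm_dotDr rmorphD /= -!herm_dotC. Qed.

Lemma herm_dotZl a u v : herm_dot (a *: u) v = Num.conj a * herm_dot u v.
Proof. by rewrite herm_dotC herm_dotZr rmorphM /= -herm_dotC. Qed.

Lemma cmodE (z : R[i]) : (cmod z)%:C = `|z|.
Proof. by []. Qed.

Lemma cmod_ge0 (z : R[i]) : 0 <= cmod z.
Proof. by case: z => a b; exact: sqrtr_ge0. Qed.

Lemma cmod_sqr (z : R[i]) : (cmod z ^+ 2)%:C = Num.conj z * z.
Proof. by rewrite -normCKC rmorphXn. Qed.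

Lemma herm_dot_norm2 u : herm_dot u u = (norm2 u ^+ 2)%:C.
Proof.
rewrite /norm2 sqr_sqrtr ?sumr_ge0// => [|i _]; last exact: sqr_ge0.
rewrite /herm_dot mxE rmorph_sum /=; apply: eq_bigr => i _.
by rewrite !mxE rmorphXn /= cmodE normCKC.
Qed.

Lemma cauchy_schwarz u v :
  cmod (herm_dot u v) ^+ 2 <= norm2 u ^+ 2 * norm2 v ^+ 2.
Proof.
rewrite -lecR rmorphXn rmorphM /= -!herm_dot_norm2 cmodE !herm_dotE mulrC.
exact: (CauchySchwarz (@dotmx R[i] M)).
Qed.

Lemma gram_ineq u v {w} : norm2 w = 1 ->
  (cmod (herm_dot u v) - cmod (herm_dot w u) * cmod (herm_dot w v)) ^+ 2 <=
  (norm2 u ^+ 2 - cmod (herm_dot w u) ^+ 2) *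
  (norm2 v ^+ 2 - cmod (herm_dot w v) ^+ 2).
Proof.
move=> w1; pose P x := x + (- herm_dot w x) *: w.
have PE x y : herm_dot (P x) (P y) =
    herm_dot x y - Num.conj (herm_dot w x) * herm_dot w y.
  rewrite /P !(herm_dotDr, herm_dotDl, herm_dotZr, herm_dotZl).
  by rewrite herm_dot_norm2 w1 expr1n rmorph1 (herm_dotC w x) rmorphN /=; ring.
have Pn x : norm2 (P x) ^+ 2 = norm2 x ^+ 2 - cmod (herm_dot w x) ^+ 2.
  apply: complexI; rewrite -herm_dot_norm2 PE herm_dot_norm2 -cmod_sqr.
  by rewrite -rmorphB.
rewrite -!Pn; apply: le_trans (cauchy_schwarz _ _).
rewrite -real_normK ?num_real// ler_pXn2r ?nnegrE ?cmod_ge0// PE.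
(* The reverse triangle inequality trades the complex difference for the difference of the
   moduli. *)
rewrite -lecR cmodE; apply: le_trans (ler_dist_dist _ _).
rewrite normrM norm_conjC -!cmodE -rmorphM -rmorphB.
by rewrite lecR /= expr0n addr0 sqrtr_sqr.
Qed.

Lemma norm2_ge0 u : 0 <= norm2 u.
Proof. exact: sqrtr_ge0. Qed.

Lemma norm2_gt0 u : u <> 0 -> 0 < norm2 u.
Proof.
move=> u0; rewrite lt_def norm2_ge0 andbT; apply/eqP => n0; apply: u0.
have := herm_dot_norm2 u; rewrite n0 expr0n herm_dotE => /eqP.
by rewrite dnorm_eq0 => /eqP/(congr1 trmx); rewrite trmxK trmx0.
Qed.
End HermDot.

(** * Choice of the dominating weight, over the reals *)

(** Here [n] stands for the norm of the direction of weight [t], and the gains are compared with the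
    division by [n] cleared. It is quantified as a nonnegative root because a [realFieldType] need
    not have square roots. *)
Lemma dominating_weight {R : realFieldType} {A B g x y : R} :
  0 < A -> 0 < B -> 0 <= g -> 0 <= x -> 0 <= y -> x ^+ 2 <= A -> y ^+ 2 <= B ->
  (g - x * y) ^+ 2 <= (A - x ^+ 2) * (B - y ^+ 2) ->
  exists2 t, 0 <= t <= 1 & forall n, 0 <= n ->
    n ^+ 2 = t ^+ 2 * A + 2 * t * (1 - t) * g + (1 - t) ^+ 2 * B ->
    x * n <= t * A + (1 - t) * g /\ y * n <= t * g + (1 - t) * B.
Proof.
move=> A0 B0 g0 x0 y0 xA yB ell.
have [l0|l0] := leP (x * B - y * g) 0.
  exists 0; first by rewrite lexx ler01.
  move=> n n0 nE; have {}nE : n ^+ 2 = B by rewrite nE; ring.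
  have yn : y <= n by rewrite -(ler_pXn2r (ltn0Sn 1)) ?nnegrE// nE.
  have n_gt0 : 0 < n by rewrite lt_def n0 andbT -sqrf_eq0 nE gt_eqF.
  split; last by rewrite -nE; nra.
  (* The case hypothesis enters after multiplying by [n]: x n^2 = x B <= y g <= n g. *)
  suff : x * n * n <= g * n by rewrite ler_pM2r//; lra.
  have -> : x * n * n = x * B by rewrite -nE; ring.
  have := ler_wpM2l g0 yn; lra.
have [m0|m0] := leP (y * A - x * g) 0.
  exists 1; first by rewrite lexx ler01.
  move=> n n0 nE; have {}nE : n ^+ 2 = A by rewrite nE; ring.
  have xn : x <= n by rewrite -(ler_pXn2r (ltn0Sn 1)) ?nnegrE// nE.
  have n_gt0 : 0 < n by rewrite lt_def n0 andbT -sqrf_eq0 nE gt_eqF.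
  split; first by rewrite -nE; nra.
  suff : y * n * n <= g * n by rewrite ler_pM2r//; lra.
  have -> : y * n * n = y * A by rewrite -nE; ring.
  have := ler_wpM2l g0 xn; lra.
(* The weights [l, m] solve [l * A + m * g = x * D] and [l * g + m * B = y * D]. *)
set l := x * B - y * g in l0 *; set m := y * A - x * g in m0 *.
pose D := A * B - g ^+ 2.
have lE : l * A + m * g = x * D by rewrite /l /m /D; ring.
have mE : l * g + m * B = y * D by rewrite /l /m /D; ring.
have s0 : 0 < l + m by rewrite addr_gt0.
exists (l / (l + m)).
  apply/andP; split; first by rewrite divr_ge0// ltW.
  by rewrite ler_pdivrMr// mul1r lerDl ltW.
have -> : 1 - l / (l + m) = m / (l + m) by field; rewrite gt_eqF.
move=> n n0 nE.
(* At the unnormalized weights the quadratic form is l (l A + m g) + m (l g + m B), which [lE] and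
   [mE] evaluate. *)
have n2E : (n * (l + m)) ^+ 2 = (l * x + m * y) * D.
  rewrite exprMn nE; transitivity (l * (l * A + m * g) + m * (l * g + m * B)).
    by field; rewrite gt_eqF.
  by rewrite lE mE; ring.
(* As x >= 0, the positivity of x D = l A + m g forces D > 0. *)
have D0 : 0 < D.
  have : 0 < x * D by rewrite -lE ltr_wpDr ?mulr_gt0// mulr_ge0// ltW.
  by nra.
(* Since l x + m y = x^2 B + y^2 A - 2 x y g, the bound l x + m y <= D is [ell] expanded. *)
have nD : n * (l + m) <= D.
  rewrite -(ler_pXn2r (ltn0Sn 1)) ?nnegrE ?(ltW D0) ?mulr_ge0// ?(ltW s0)// n2E [leRHS]expr2.
  by rewrite ler_pM2r// /l /m /D; nra.
have xE : l / (l + m) * A + m / (l + m) * g = x * D / (l + m).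
  by rewrite -lE; field; rewrite gt_eqF.
have yE : l / (l + m) * g + m / (l + m) * B = y * D / (l + m).
  by rewrite -mE; field; rewrite gt_eqF.
by rewrite xE yE !ler_pdivlMr// -!mulrA !ler_wpM2l.
Qed.

(** * Phases, gains and norms of the beams *)

Lemma conj_cis (R : realType) (t : R) : Num.conj (cis t) = cis (- t).
Proof. by rewrite /cis cosN sinN. Qed.

Lemma cisNK (R : realType) (t : R) : cis (- t) * cis t = 1.
Proof.
rewrite /cis cosN sinN; apply/eqP; rewrite eq_complex /=.
rewrite -!expr2 mulNr opprK -!expr2 cos2Dsin2 eqxx /=; apply/eqP; ring.
Qed.

Lemma conj_real (R : realType) (x : R) : Num.conj x%:C = x%:C.
Proof. exact: conjc_real. Qed.

Lemma cmod_cis (R : realType) (t : R) : cmod (cis t) = 1.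
Proof. by rewrite /= cos2Dsin2 sqrtr1. Qed.

Section Beam.
Context {R : realType} {M : nat}.
Context {N L : nat} {p alpha_s : R} {hc hs : 'cV[R[i]]_M}.
Context (N_ge1 : (1 <= N)%N) (L_ge1 : (1 <= L)%N).
Context (p_gt0 : 0 < p) (alpha_s_gt0 : 0 < alpha_s).
Context (hc_neq0 : hc <> 0) (hs_neq0 : hs <> 0).

Let t := - carg (alpha12 N L p alpha_s hc hs).
Let g := cmod (herm_dot hc hs).
Let A := norm2 hc ^+ 2.
Let B := norm2 hs ^+ 2.
Let u := beam_dir N L p alpha_s hc hs.

Let NL_gt0 : 0 < N%:R * L%:R :> R. Proof. by rewrite mulr_gt0 ?ltr0n. Qed.

(** [alpha12] is a positive multiple of [herm_dot hc hs], so the factor cancels from its polar form,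
    also when the product is 0. *)
Lemma phase_alignment : cis t * herm_dot hc hs = g%:C.
Proof.
set k := p * Num.sqrt (N%:R * L%:R * alpha_s).
have k0 : 0 < k by rewrite mulr_gt0// sqrtr_gt0 mulr_gt0.
have kC0 : k%:C != 0 by rewrite eq_complex /= eqxx andbT gt_eqF.
have [e _] := cargE (alpha12 N L p alpha_s hc hs).
have cE : cmod (alpha12 N L p alpha_s hc hs) = k * g.
  apply: complexI; rewrite rmorphM /= cmodE normrM -!cmodE [cmod k%:C]/=.
  by rewrite expr0n addr0 sqrtr_sqr gtr0_norm.
apply: (mulfI kC0); rewrite mulrCA -/(alpha12 N L p alpha_s hc hs) e cE.
by rewrite mulrCA cisNK mulr1 rmorphM.
Qed.

Lemma herm_dot_beam_dir_hc xi :
  herm_dot (u xi) hc = (xi * A + (1 - xi) * g)%:C.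
Proof.
have e : Num.conj (cis t) * herm_dot hs hc = g%:C.
  by rewrite (herm_dotC hc) -rmorphM phase_alignment; exact: conj_real.
rewrite herm_dotDl !herm_dotZl rmorphM /= -mulrA e herm_dot_norm2.
by rewrite !conj_real -!rmorphM -rmorphD.
Qed.

(** The factor [cis t] makes the product real without changing its modulus. *)
Lemma herm_dot_beam_dir_hs xi :
  cis t * herm_dot (u xi) hs = (xi * g + (1 - xi) * B)%:C.
Proof.
rewrite herm_dotDl !herm_dotZl rmorphM /= mulrDr mulrCA phase_alignment.
rewrite !conj_real conj_cis herm_dot_norm2 -mulrA mulrCA [cis t * _]mulrA.
by rewrite [cis t * _]mulrC cisNK mul1r -!rmorphM -rmorphD.
Qed.

Lemma norm2_beam_dir xi : norm2 (u xi) ^+ 2 =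
  xi ^+ 2 * A + 2 * xi * (1 - xi) * g + (1 - xi) ^+ 2 * B.
Proof.
apply: complexI; rewrite -herm_dot_norm2 [X in herm_dot _ X]/u /beam_dir.
rewrite herm_dotDr !herm_dotZr -mulrA herm_dot_beam_dir_hc herm_dot_beam_dir_hs.
rewrite -!rmorphM -rmorphD; congr (_%:C); ring.
Qed.

Lemma norm2_beam_dir_gt0 {xi} : 0 <= xi <= 1 -> 0 < norm2 (u xi).
Proof.
move=> /andP[xi0 xi1].
have A0 : 0 < A by rewrite exprn_gt0// norm2_gt0.
have B0 : 0 < B by rewrite exprn_gt0// norm2_gt0.
have g0 : 0 <= g := cmod_ge0 _.
rewrite lt_def norm2_ge0 andbT -sqrf_eq0 norm2_beam_dir gt_eqF//.
(* All three terms are nonnegative; the first is positive unless [xi] is 0, where the last equals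
   [B]. *)
have [->|xi_neq0] := eqVneq xi 0; first by rewrite subr0; lra.
rewrite -addrA ltr_wpDr//; last by rewrite mulr_gt0// exprn_gt0// lt_def xi_neq0.
have xi1' : 0 <= 1 - xi by rewrite subr_ge0.
apply: addr_ge0; last by apply: mulr_ge0; [exact: exprn_ge0 | exact: ltW].
by apply: mulr_ge0 => //; rewrite !mulr_ge0.
Qed.

Lemma norm2_beam {xi} : 0 <= xi <= 1 -> norm2 (beam N L p alpha_s hc hs xi) = 1.
Proof.
move=> /norm2_beam_dir_gt0 n0; apply/eqP; rewrite -sqrp_eq1 ?norm2_ge0//.
apply/eqP/complexI; rewrite -herm_dot_norm2 herm_dotZl herm_dotZr.
rewrite conj_real herm_dot_norm2 -!rmorphM; congr (_%:C).
by rewrite -/u; field; rewrite gt_eqF.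
Qed.

Lemma cmod_beam {xi} v : 0 <= xi <= 1 ->
  cmod (herm_dot (beam N L p alpha_s hc hs xi) v) =
  cmod (herm_dot (u xi) v) / norm2 (u xi).
Proof.
move=> /norm2_beam_dir_gt0 n0; rewrite herm_dotZl conj_real.
rewrite ComplexField.Normc.normcM mulrC; congr (_ * _).
by rewrite /= expr0n addr0 sqrtr_sqr gtr0_norm ?invr_gt0.
Qed.

Lemma beam_dominates {w} : norm2 w = 1 -> exists2 xi, 0 <= xi <= 1 &
  cmod (herm_dot w hc) <= cmod (herm_dot (beam N L p alpha_s hc hs xi) hc) /\
  cmod (herm_dot w hs) <= cmod (herm_dot (beam N L p alpha_s hc hs xi) hs).
Proof.
move=> w1; have g0 : 0 <= g := cmod_ge0 _.
have A0 : 0 < A by rewrite exprn_gt0// norm2_gt0.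
have B0 : 0 < B by rewrite exprn_gt0// norm2_gt0.
have wA := cauchy_schwarz w hc; rewrite w1 expr1n mul1r in wA.
have wB := cauchy_schwarz w hs; rewrite w1 expr1n mul1r in wB.
have [xi xi01 P] := dominating_weight A0 B0 g0 (cmod_ge0 _) (cmod_ge0 _) wA wB
  (gram_ineq hc hs w1).
exists xi => //; have n0 := norm2_beam_dir_gt0 xi01.
have [Pc Ps] := P _ (ltW n0) (norm2_beam_dir xi).
rewrite !cmod_beam// !ler_pdivlMr//; split.
  by rewrite herm_dot_beam_dir_hc (le_trans Pc)//= expr0n addr0 sqrtr_sqr ler_norm.
have -> : cmod (herm_dot (u xi) hs) = cmod (cis t * herm_dot (u xi) hs).
  by rewrite ComplexField.Normc.normcM cmod_cis mul1r.
by rewrite herm_dot_beam_dir_hs (le_trans Ps)//= expr0n addr0 sqrtr_sqr ler_norm.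
Qed.
End Beam.

(** * From gains to rates and Pareto optimality *)

Lemma ler_log2 (R : realType) (x y : R) : 0 < x -> x <= y -> log2 x <= log2 y.
Proof.
move=> x0 xy; rewrite ler_pM2r ?invr_gt0 ?ln_gt0 ?ltr1n// ler_ln ?posrE//.
exact: lt_le_trans xy.
Qed.

Lemma ler_log2_snr (R : realType) (k x y : R) : 0 <= k -> 0 <= x -> x <= y ->
  log2 (1 + k * x ^+ 2) <= log2 (1 + k * y ^+ 2).
Proof.
move=> k0 x0 xy; apply: ler_log2; first by rewrite ltr_wpDr// mulr_ge0// exprn_ge0.
by rewrite lerD2l ler_wpM2l// lerXn2r// nnegrE// (le_trans x0).
Qed.

Lemma pareto_boundary_eq {R : realType} {S : set (R * R)} {x y : R * R} :
  pareto_boundary S x -> S y -> x.1 <= y.1 -> x.2 <= y.2 -> x = y.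
Proof.
move=> [_ nd] Sy; case: x y nd Sy => [x1 x2] [y1 y2] nd Sy /= le1 le2.
congr pair; apply/eqP; rewrite eq_le ?le1 ?le2 leNgt; apply/negP => lt.
- by apply: nd; exists (y1, y2); split => //; left.
- by apply: nd; exists (y1, y2); split => //; right.
Qed.

Theorem corollary1 (R : realType) (M N L : nat) (p alpha_s : R)
    (hc hs : 'cV[R[i]]_M)
    (M_ge1 : (1 <= M)%N) (N_ge1 : (1 <= N)%N) (L_ge1 : (1 <= L)%N)
    (p_gt0 : 0 < p) (alpha_s_gt0 : 0 < alpha_s)
    (hc_neq0 : hc <> 0) (hs_neq0 : hs <> 0) :
  forall r : R * R,
    pareto_boundary (rate_region N L p alpha_s hc hs) r ->
    exists xi : R, 0 <= xi <= 1 /\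
      r = (sens_rate N L p alpha_s hs (beam N L p alpha_s hc hs xi),
           comm_rate p hc (beam N L p alpha_s hc hs xi)).
Proof.
move=> r r_pareto; have [w w1 rE] := r_pareto.1.
have [xi xi01 [le_c le_s]] :=
  beam_dominates N_ge1 L_ge1 p_gt0 alpha_s_gt0 hc_neq0 hs_neq0 w1.
exists xi; split=> //; apply: (pareto_boundary_eq r_pareto); rewrite -?rE /=.
- exists (beam N L p alpha_s hc hs xi) => //=.
  exact: (norm2_beam N_ge1 L_ge1 p_gt0 alpha_s_gt0 hc_neq0 hs_neq0).
- rewrite ler_wpM2l ?invr_ge0// ler_log2_snr ?cmod_ge0//.
  by rewrite !mulr_ge0// ltW.
- by rewrite ler_log2_snr ?cmod_ge0// ltW.
Qed.
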